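(* Let $r,n$ be positive integers with $1 \le r < n-1$, and let $z^*\in\mathbb{C}$ be any zero of $B_{r,n}(z) = \sum_{k=0}^r \binom{n}{k} z^k$. Then all of the following hold: (1) $|z^*| \le \dfrac{r}{n+1-r}$; (2) $\left| z^* - \dfrac{\gamma^2}{1-\gamma^2} \right| \le \dfrac{\gamma}{1-\gamma^2}$, where $\gamma = \dfrac{r}{n-1}$; (3) $\operatorname{Re} z^* > -\dfrac12$; (4) $z^*$ lies exterior to the closed curve $C_{r/n}$.
   Context: For $0<\alpha<1$ define $K_\alpha = \alpha^\alpha (1-\alpha)^{1-\alpha}$ and $$C_\alpha = \left\{ z\in\mathbb{C} : \frac{|z|^\alpha}{|1+z|} = K_\alpha,\ |z| \le \frac{\alpha}{1-\alpha} \right\}.$$ The set $C_\alpha$ is a simple closed curve in the plane, starlike with respect to $0$; ''exterior to $C_\alpha$'' means lying in the unbounded component of $\mathbb{C}\setminus C_\alpha$ (so neither on the curve nor inside it). *)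

(* Defs.v *)
From mathcomp Require Import all_boot all_order all_algebra.
From mathcomp Require Import complex.
From mathcomp Require Import all_classical all_reals all_analysis.

Set Implicit Arguments.
Unset Strict Implicit.
Unset Printing Implicit Defensive.

Import Order.TTheory GRing.Theory Num.Theory.
Import numFieldNormedType.Exports.

Local Open Scope classical_set_scope.
Local Open Scope ring_scope.

(* On R[i] the norm `|z| takes its values in R[i] itself, so the modulus as an
   element of R is its real part.  The topology and the norm on the complex
   plane are those of the alias R[i]^o, induced by this norm. *)
Definition modulus (R : realType) (z : R[i]) : R := complex.Re `|z|.

Definition binom_section (R : realType) (r n : nat) : {poly R[i]} :=
  \sum_(k < r.+1) 'C(n, k)%:R *: 'X^k.

Definition K_const (R : realType) (a : R) : R := a `^ a * (1 - a) `^ (1 - a).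

(* At z = -1 the quotient is 0 by the convention x / 0 = 0, which differs from
   K_const a > 0 when 0 < a < 1, so -1 is never on the curve. *)
Definition C_curve (R : realType) (a : R) : set R[i]^o :=
  [set z : R[i]^o | modulus z `^ a / modulus (1 + z) = K_const a
                    /\ modulus z <= a / (1 - a)].

(* The complement of a bounded set in the plane has exactly one unbounded
   component, so for bounded G this is that component. *)
Definition exterior (R : realType) (G : set R[i]^o) : set R[i]^o :=
  [set z : R[i]^o | ~ G z /\ ~ bounded_set (connected_component (~` G) z)].

(* Main.v *)
(** Parts (1) and (2) are the Eneström–Kakeya theorem, applied to [B] itself
    and, after the substitution [w = z / (1 + z)], to
    [(1 + z)^-r B(z) = \sum_(j <= r) 'C(n - r - 1 + j, j) w^j]; (3) follows
    since (2) says [|z| <= gamma |1 + z|] with [gamma < 1].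

    For (4) put [a = r / n] and [rho = a / (1 - a)], so that
    [K_a (1 + rho) = rho^a].  A zero [z] satisfies
    [(1 + z)^n = \sum_(k > r) 'C(n, k) z^k], and as [|z| <= rho] the right-hand
    side is smaller in modulus than [(|z| / rho)^r (1 + rho)^n]; taking [n]-th
    roots, [|z|^a > K_a |1 + z|].  The function [s^a - K_a |1 + s u|] of
    [s], with [u = z / |z|], is concave, positive at [s = |z|], and positive at
    [s = rho] because [u != 1]; so the ray from [z] away from [0] never meets the
    curve. *)
Require Import Defs.
From mathcomp Require Import all_boot all_order all_algebra.
From mathcomp Require Import complex.
From mathcomp Require Import all_classical all_reals all_analysis.
From mathcomp Require Import ring lra zify.

Import Order.TTheory GRing.Theory Num.Theory.
Import numFieldNormedType.Exports.

Local Open Scope ring_scope.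
Local Open Scope complex_scope.

(** * Eneström-Kakeya bound and truncated binomial sums *)

Lemma telescoped_linear_mul (F : comRingType) (a : nat -> F) (c x : F) (r : nat) :
  (x - c) * (\sum_(k < r.+1) a k * x ^+ k)
  = a r * x ^+ r.+1 - c * a 0%N
    - \sum_(k < r) (c * a k.+1 - a k) * x ^+ k.+1.
Proof.
elim: r => [|r IH]; first by rewrite big_ord_recr !big_ord0 /=; ring.
by rewrite big_ord_recr mulrDr IH [in RHS]big_ord_recr /= !exprS; ring.
Qed.

(** Multiplying by [x - c] leaves a single positive coefficient, the top one. At a zero the top term
    balances the others, so the triangle inequality makes the same product at [|z|] nonpositive; it
    is positive if [c < |z|]. *)
Lemma enestrom_kakeya (F : numFieldType) (a : nat -> F) (c z : F) (r : nat) :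
  0 <= c -> (forall k, (k <= r)%N -> 0 < a k) ->
  (forall k, (k < r)%N -> a k <= c * a k.+1) ->
  \sum_(k < r.+1) a k * z ^+ k = 0 -> `|z| <= c.
Proof.
move=> c0 a0 ac az0; rewrite real_leNgt ?normr_real ?ger0_real//.
apply/negP => cz.
have z0 : 0 < `|z| by exact: le_lt_trans cz.
have pz0 : 0 < \sum_(k < r.+1) a k * `|z| ^+ k.
  rewrite big_ord_recr /= ltr_wpDl ?mulr_gt0 ?exprn_gt0 ?a0//.
  apply: sumr_ge0 => k _; rewrite mulr_ge0 ?exprn_ge0//.
  by apply/ltW/a0/ltnW.
have pz_gt0 : 0 < (`|z| - c) * (\sum_(k < r.+1) a k * `|z| ^+ k).
  by rewrite mulr_gt0 ?subr_gt0.
have := telescoped_linear_mul F a c z r.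
rewrite az0 mulr0 => /esym/eqP; rewrite -addrA -opprD subr_eq0 => /eqP top.
have d0 k : (k < r)%N -> 0 <= c * a k.+1 - a k by move=> kr; rewrite subr_ge0 ac.
have : `|a r * z ^+ r.+1| <=
    c * a 0%N + \sum_(k < r) (c * a k.+1 - a k) * `|z| ^+ k.+1.
  rewrite top; apply: (le_trans (ler_normD _ _)); apply: lerD.
    by rewrite ger0_norm// mulr_ge0// ltW// a0.
  apply: (le_trans (ler_norm_sum _ _ _)); apply: ler_sum => k _.
  by rewrite normrM normrX ger0_norm ?d0.
rewrite normrM normrX gtr0_norm ?a0// -subr_le0 opprD addrA.
by rewrite -telescoped_linear_mul lt_geF.
Qed.

Lemma sum_binS (F : comRingType) (N r : nat) (z : F) :
  \sum_(k < r.+2) 'C(N.+1, k)%:R * z ^+ k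
  = (1 + z) * (\sum_(k < r.+1) 'C(N, k)%:R * z ^+ k)
    + 'C(N, r.+1)%:R * z ^+ r.+1.
Proof.
elim: r => [|r IH].
  by rewrite !big_ord_recr !big_ord0 /= binS !bin0 bin1 natrD; ring.
by rewrite big_ord_recr IH [in RHS]big_ord_recr /= binS natrD !exprS; ring.
Qed.

(** The ['C(m + j, j)] are the coefficients of [(1 - w)^-(m+1)] at [w = z / (1 + z)]; with
    denominators cleared, [z = -1] is allowed. Raising [r] also raises the upper index, so the
    summed Pascal rule multiplies by [1 + z] and adds one term. *)
Lemma sum_bin_negative_binomial (F : comRingType) (m r : nat) (z : F) :
  \sum_(k < r.+1) 'C(m + r.+1, k)%:R * z ^+ k
  = \sum_(j < r.+1) 'C(m + j, j)%:R * z ^+ j * (1 + z) ^+ (r - j).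
Proof.
elim: r => [|r IH]; first by rewrite !big_ord_recr !big_ord0 /= !bin0; ring.
rewrite addnS sum_binS IH [in RHS]big_ord_recr /= subnn expr0 mulr1.
congr (_ + _); rewrite mulr_sumr; apply: eq_bigr => j _.
by rewrite (subSn (_ : j <= r)%N) 1?exprS ?(leq_ord j)//; ring.
Qed.

Lemma binom_sectionE (R : realType) (r n : nat) (z : R[i]) :
  (binom_section R r n).[z] = \sum_(k < r.+1) 'C(n, k)%:R * z ^+ k.
Proof.
by rewrite horner_sum; apply: eq_bigr => k _; rewrite hornerZ hornerXn.
Qed.

Lemma sum_bin_zero_neq0 (F : numFieldType) (r n : nat) (z : F) :
  \sum_(k < r.+1) 'C(n, k)%:R * z ^+ k = 0 -> z != 0.
Proof.
apply: contra_eq_neq => ->; rewrite big_ord_recl big1 /=.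
  by rewrite bin0 addr0 mulr1 oner_eq0.
by move=> i _; rewrite exprS mul0r mulr0.
Qed.

Lemma sum_bin_zero_lt (F : numFieldType) (r n : nat) (z c : F) : (r <= n)%N ->
  0 < c -> `|z| <= c ->
  \sum_(k < r.+1) 'C(n, k)%:R * z ^+ k = 0 ->
  `|1 + z| ^+ n * c ^+ r < `|z| ^+ r * (1 + c) ^+ n.
Proof.
move=> rn c0 zc Bz0; have z0 := sum_bin_zero_neq0 _ _ _ _ Bz0.
have expand (x : F) : (1 + x) ^+ n = \sum_(0 <= k < r.+1) 'C(n, k)%:R * x ^+ k
    + \sum_(r.+1 <= k < n.+1) 'C(n, k)%:R * x ^+ k.
  rewrite -big_cat_nat//= big_mkord addrC exprD1n.
  by apply: eq_bigr => k _; rewrite mulr_natl.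
(* The low-order terms survive at [c] but cancel at [z]; this makes the inequality strict. *)
have head_gt0 : 0 < \sum_(0 <= k < r.+1) 'C(n, k)%:R * c ^+ k.
  rewrite big_nat_recl// bin0 expr0 mulr1 ltr_pwDl//.
  by apply: sumr_ge0 => k _; rewrite mulr_ge0// exprn_ge0// ltW.
rewrite -normrX !expand big_mkord Bz0 add0r mulrDr.
rewrite ltr_pwDl ?mulr_gt0 ?exprn_gt0 ?normr_gt0//.
apply: (@le_trans _ _ (\sum_(r.+1 <= k < n.+1) 'C(n, k)%:R * `|z| ^+ k * c ^+ r)).
  rewrite -mulr_suml ler_wpM2r ?exprn_ge0 ?(ltW c0)//.
  apply: (le_trans (ler_norm_sum _ _ _)); apply: ler_sum => k _.
  by rewrite normrM normrX normr_nat.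
rewrite mulr_sumr big_nat_cond [leRHS]big_nat_cond; apply: ler_sum => k.
rewrite andbT => /andP[/ltnW rk _].
have split_exp (x : F) : x ^+ k = x ^+ r * x ^+ (k - r) by rewrite -exprD subnKC.
have -> : 'C(n, k)%:R * `|z| ^+ k * c ^+ r =
    'C(n, k)%:R * `|z| ^+ r * c ^+ r * `|z| ^+ (k - r).
  by rewrite split_exp; ring.
have -> : `|z| ^+ r * ('C(n, k)%:R * c ^+ k) =
    'C(n, k)%:R * `|z| ^+ r * c ^+ r * c ^+ (k - r).
  by rewrite split_exp; ring.
apply: ler_wpM2l; first by rewrite !mulr_ge0// exprn_ge0// ltW.
by rewrite lerXn2r// nnegrE ltW.
Qed.

(** * The real-valued modulus *)

Section Modulus.
Variable R : realType.
Implicit Types z w : R[i].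

Lemma normr_modulus z : `|z| = (modulus z)%:C.
Proof. by rewrite RRe_real ?normr_real. Qed.

Lemma modulus_le z (x : R) : (modulus z <= x) = (`|z| <= x%:C).
Proof. by rewrite normr_modulus lecR. Qed.

Lemma modulus_ge0 z : 0 <= modulus z.
Proof. by rewrite -ler0c -normr_modulus. Qed.

Lemma modulus_gt0 z : (0 < modulus z) = (z != 0).
Proof. by rewrite -ltcR -normr_modulus rmorph0 normr_gt0. Qed.

Lemma modulusM z w : modulus (z * w) = modulus z * modulus w.
Proof. by apply: complexI; rewrite rmorphM /= -!normr_modulus normrM. Qed.

Lemma modulus_real (x : R) : 0 <= x -> modulus x%:C = x.
Proof. by move=> x0; apply: complexI; rewrite -normr_modulus ger0_norm ?ler0c. Qed.

Lemma modulusD z w : modulus (z + w) <= modulus z + modulus w.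
Proof. by rewrite modulus_le rmorphD /= -!normr_modulus ler_normD. Qed.

Lemma natr_le_real_complexM (p q : nat) (c : R) :
  (p%:R <= c * q%:R) -> (p%:R <= c%:C * q%:R :> R[i]).
Proof. by rewrite -!(rmorph_nat (real_complex R)) -rmorphM /= lecR. Qed.

Lemma modulus_sqr z : modulus z ^+ 2 = complex.Re z ^+ 2 + complex.Im z ^+ 2.
Proof. by apply: complexI; rewrite rmorphXn /= -normr_modulus add_Re2_Im2. Qed.

Lemma modulus_1D_lt z : ~~ (0 <= z) -> modulus (1 + z) < 1 + modulus z.
Proof.
move=> z0; have le1D : modulus (1 + z) <= 1 + modulus z.
  by have := modulusD 1 z; rewrite (modulus_real 1 ler01).
rewrite lt_neqAle le1D andbT.
apply: contra z0 => /eqP e.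
have : `|1 + z| = `|1| + `|z| by rewrite normr1 !normr_modulus e rmorphD rmorph1.
(* Equality in the triangle inequality forces a common direction [t], and the summand 1 forces
   [t = 1]. *)
case/normCDeq => t _ []; rewrite normr1 mul1r => <- ->.
by rewrite mulr1.
Qed.

End Modulus.

(** * Concavity of real powers and the constant [K_const] *)

Section PowR.
Variable R : realType.
Implicit Types a x y : R.

Lemma powR_le_tangent1 a x : 0 < a < 1 -> 0 < x -> x `^ a <= 1 + a * (x - 1).
Proof.
move=> /andP[a0 a1] x0; have a'0 : 0 < 1 - a by rewrite subr_gt0.
have := @conjugate_powR R (x `^ a) 1 a^-1 (1 - a)^-1 (powR_ge0 _ _) ler01.
rewrite !invr_gt0 !invrK mulr1 -powRrM divff ?gt_eqF// powRr1 ?(ltW x0)// powR1 mul1r.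
move=> /(_ a0 a'0 (subrKC _ _)) young.
by rewrite (_ : 1 + _ = x * a + (1 - a)); [exact: young|ring].
Qed.

Lemma concave_powR a (l : R) x y : 0 < a < 1 -> 0 <= l <= 1 -> 0 < x -> 0 < y ->
  (1 - l) * x `^ a + l * y `^ a <= ((1 - l) * x + l * y) `^ a.
Proof.
move=> a01 /andP[l0 l1] x0 y0; set m := (1 - l) * x + l * y.
have m0 : 0 < m by rewrite /m; nra.
have tangent t : 0 < t -> t `^ a <= m `^ a * (1 + a * (t / m - 1)).
  move=> t0; rewrite -{1}(divfK (lt0r_neq0 m0) t) powRM;
    rewrite ?divr_ge0 ?(ltW t0, ltW m0)// mulrC.
  by rewrite ler_wpM2l ?powR_ge0// powR_le_tangent1 ?divr_gt0.
have l'0 : 0 <= 1 - l by rewrite subr_ge0.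
apply: (le_trans (lerD (ler_wpM2l l'0 (tangent x x0)) (ler_wpM2l l0 (tangent y y0)))).
rewrite [leLHS](_ : _ = m `^ a * (1 + a * (m / m - 1))); last by rewrite /m; ring.
by rewrite divff ?gt_eqF// subrr mulr0 addr0 mulr1.
Qed.

Lemma K_const_gt0 a : 0 < a < 1 -> 0 < K_const a.
Proof. by move=> /andP[a0 a1]; rewrite mulr_gt0 ?powR_gt0 ?subr_gt0. Qed.

(** Follows from [1 + a / (1 - a) = 1 / (1 - a)]. It says that the curve passes through the positive
    real point [a / (1 - a)]. *)
Lemma K_constM a : 0 < a < 1 ->
  K_const a * (1 + a / (1 - a)) = (a / (1 - a)) `^ a.
Proof.
move=> /andP[a0 a1]; have a'0 : 0 < 1 - a by rewrite subr_gt0.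
rewrite powRM ?invr_ge0 ?(ltW a0, ltW a'0)// /K_const -mulrA; congr (_ * _).
have -> : (1 - a)^-1 `^ a = ((1 - a) `^ a)^-1.
  by rewrite -powR_inv1 ?(ltW a'0)// -powRrM mulN1r powRN.
rewrite powRB ?gt_eqF ?implybT// powRr1 ?(ltW a'0)//; field.
by rewrite !gt_eqF ?powR_gt0.
Qed.

End PowR.

(** * Rays that avoid the curve and escape to infinity *)

Section Ray.
Variable R : realType.
Implicit Types z w : R[i].

Lemma off_curve (a : R) z : 0 < a < 1 ->
  (modulus z <= a / (1 - a) -> K_const a * modulus (1 + z) < modulus z `^ a) ->
  ~ C_curve a z.
Proof.
move=> a01 Kz [eqK /Kz]; rewrite -eqK.
have := K_const_gt0 _ _ a01; rewrite -eqK.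
case: (eqVneq (modulus (1 + z)) 0) => [->|z1 _]; first by rewrite invr0 mulr0 ltxx.
by rewrite divfK// ltxx.
Qed.

Lemma ray_off_curve (a t : R) z : 0 < a < 1 -> 1 <= t -> ~~ (0 <= z) ->
  modulus z < a / (1 - a) -> K_const a * modulus (1 + z) < modulus z `^ a ->
  ~ C_curve a (t%:C * z).
Proof.
move=> a01 t1 zN0; set c := a / (1 - a) => zc Kz; apply: off_curve => //.
have K0 := K_const_gt0 _ _ a01; have /andP[a0 a1] := a01.
have c0 : 0 < c by rewrite divr_gt0 ?subr_gt0.
have t0 : 0 <= t by rewrite (le_trans _ t1).
have s0 : 0 < modulus z.
  by rewrite modulus_gt0; apply: contraNneq zN0 => ->.
rewrite modulusM modulus_real// -/c => tzc.
set s := modulus z in zc Kz s0 tzc *.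
(* [l] locates [t * s] on the segment from [s] to [c]; [v] below is the point of the ray on the
   circle of radius [c]. *)
pose l := (t * s - s) / (c - s).
have cs0 : 0 < c - s by rewrite subr_gt0.
have l0 : 0 <= l by rewrite divr_ge0 ?(ltW cs0)// subr_ge0 ler_peMl// ltW.
have l1 : 0 <= 1 - l by rewrite subr_ge0 ler_pdivrMr// mul1r lerD2r.
pose v := (c / s)%:C * z.
have lE : l * (c - s) = t * s - s by rewrite /l divfK ?gt_eqF.
have tsE : t * s = (1 - l) * s + l * c by move: lE; lra.
have tE : t = (1 - l) + l * (c / s).
  by apply: (mulIf (lt0r_neq0 s0)); rewrite tsE; field; rewrite gt_eqF.
have tzE : t%:C * z = (1 - l)%:C * z + l%:C * v.
  by rewrite /v {1}tE rmorphD rmorphM /=; ring.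
have vc : modulus v = c.
  have cs_ge0 : 0 <= c / s by apply/ltW/divr_gt0.
  by rewrite modulusM modulus_real // -/s divfK ?gt_eqF.
have vN0 : ~~ (0 <= v).
  by rewrite /v pmulr_rge0// ltcR divr_gt0.
have Kv : K_const a * modulus (1 + v) < c `^ a.
  by have := modulus_1D_lt _ _ vN0; rewrite vc -(K_constM _ _ a01) -/c ltr_pM2l.
have l01 : 0 <= l <= 1 by rewrite l0 -subr_ge0.
rewrite tsE; apply: lt_le_trans (concave_powR _ _ _ _ _ a01 l01 s0 c0).
have triangle : modulus (1 + t%:C * z)
    <= (1 - l) * modulus (1 + z) + l * modulus (1 + v).
  have -> : 1 + t%:C * z = (1 - l)%:C * (1 + z) + l%:C * (1 + v).
    by rewrite tzE rmorphB rmorph1 /=; ring.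
  by apply: (le_trans (modulusD _ _ _)); rewrite !modulusM !modulus_real.
apply: (le_lt_trans (ler_wpM2l (ltW K0) triangle)).
rewrite mulrDr mulrCA [X in _ + X]mulrCA.
(* Strictness comes from [v] alone when [l = 1], and otherwise from [z], whose weight [1 - l] is
   then positive. *)
case: (eqVneq l 1) => [->|ln1]; first by rewrite subrr !mul0r !mul1r !add0r.
rewrite ltr_leD ?ler_wpM2l ?(ltW Kv)// ltr_pM2l// lt_neqAle l1 andbT eq_sym subr_eq0.
by rewrite eq_sym.
Qed.

Lemma continuous_ray z : continuous (fun t : R => t%:C * z : R[i]^o).
Proof.
move=> t; apply/cvgrPdist_lt => e; case: e => e ei.
(* The tolerance lives in [R[i]]; being positive, it is real. *)
rewrite ltcE /= => /andP[/eqP -> e0].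
have z1 : 0 < modulus z + 1 by rewrite ltr_wpDl ?modulus_ge0.
near=> u; rewrite -mulrBl -rmorphB /= normrM !normr_modulus -rmorphM /= ltcR.
have -> : modulus (t - u)%:C = `|t - u|.
  by apply: complexI; rewrite -normr_modulus normc_def /= expr0n addr0 sqrtr_sqr.
apply: (@le_lt_trans _ _ (`|t - u| * (modulus z + 1))).
  by rewrite ler_wpM2l// lerDl.
rewrite -ltr_pdivlMr//; near: u.
by apply: cvgr_dist_lt => //; rewrite divr_gt0.
Unshelve. all: by end_near. Qed.

(** The ray is connected and avoids [G], so it lies in the component of [z], which is therefore
    unbounded. *)
Lemma exterior_ray (G : set R[i]^o) z : z != 0 ->
  (forall t : R, 1 <= t -> ~ G (t%:C * z)) -> exterior G z.
Proof.
move=> z0 rayG.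
have ray_component t : 1 <= t ->
    connected_component (~` G)%classic (z : R[i]^o) (t%:C * z).
  move=> t1; apply: (@connected_component_max _ _
    ((fun t : R => t%:C * z : R[i]^o) @` `[1, +oo[)%classic).
  - by exists 1; [rewrite /= in_itv /= lexx|exact: mul1r].
  - by move=> _ [u /= + <-]; rewrite in_itv /= andbT => /rayG.
  - apply: connected_continuous_connected; first
      exact/connected_intervalP/interval_is_interval.
    by apply: continuous_subspaceT => u; exact: continuous_ray.
  - by exists t => //=; rewrite in_itv /= t1.
split; first by have := rayG 1 (lexx _); rewrite [_ * _]mul1r.
move=> [M' [_ /(_ (M' + 1))]]; rewrite ltrDl ltr01 => /(_ isT).
set M := M' + 1 => boundM.
have s0 : 0 < modulus z by rewrite modulus_gt0.
(* Chosen so that [t * z] has modulus [|z| + |Re M|], beyond the supposed bound. *)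
pose t := 1 + `|complex.Re M| / modulus z.
have t1 : 1 <= t by rewrite lerDl divr_ge0// ltW.
have := boundM _ (ray_component t t1).
rewrite /= normr_modulus lecE => /andP[_] /=; apply/negP; rewrite -ltNge.
rewrite modulusM modulus_real ?(le_trans ler01 t1)// mulrDl mul1r divfK ?gt_eqF//.
by rewrite ltr_pwDl// ler_norm.
Qed.

End Ray.

(** * Estimates at a zero of the section *)

Section BinomialSectionZero.
Variables (R : realType) (r n : nat) (z : R[i]).
Hypotheses (hr : (1 <= r)%N) (hrn : (r < n - 1)%N).
Hypothesis Bz0 : \sum_(k < r.+1) 'C(n, k)%:R * z ^+ k = 0.

(** The ratio of consecutive coefficients, [(k + 1) / (n - k)], is largest at [k = r - 1]. *)
Lemma modulus_bin_zero : modulus z <= r%:R / (n%:R + 1 - r%:R).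
Proof.
have nr0 : 0 < n%:R + 1 - r%:R :> R.
  by rewrite natr1 -natrB ?ltr0n; lia.
rewrite modulus_le; apply: (@enestrom_kakeya _ (fun k => 'C(n, k)%:R)) Bz0.
- by rewrite ler0c divr_ge0// ltW.
- by move=> k kr; rewrite ltr0n bin_gt0; lia.
move=> k kr; apply: natr_le_real_complexM.
rewrite mulrAC ler_pdivlMr// natr1 -natrB -?natrM ?ler_nat; last by lia.
rewrite -(leq_pmul2l (ltn0Sn k)) (mulnCA _ r) mul_bin_left.
rewrite (mulnCA k.+1) (mulnA r) (mulnC _ 'C(n, k)) leq_mul2l; apply/orP; right.
by apply: leq_mul; lia.
Qed.

(** Here the coefficient ratio is [(j + 1) / (m + j + 1)], largest at [j = r - 1], where it equals
    [r / (n - 1)]. *)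
Lemma modulus_ratio_bin_zero :
  modulus z <= r%:R / (n%:R - 1) * modulus (1 + z).
Proof.
have [m nE] : exists m, n = (m + r.+1)%N by exists (n - r.+1)%N; lia.
have Qz0 : \sum_(j < r.+1) 'C(m + j, j)%:R * z ^+ j * (1 + z) ^+ (r - j) = 0.
  by rewrite -sum_bin_negative_binomial -nE.
have z1 : 1 + z != 0.
  (* At [z = -1] only the term [j = r] remains, and it is nonzero. *)
  apply: contra_eq_neq Qz0 => z1; have -> : z = -1 by rewrite -(addKr 1 z) z1 addr0.
  rewrite big_ord_recr big1 /= ?add0r ?subnn ?subrr ?mulr1.
    by rewrite mulf_neq0 ?signr_eq0// pnatr_eq0 -lt0n bin_gt0 leq_addl.
  by move=> j _; rewrite expr0n subn_eq0 leqNgt ltn_ord mulr0.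
rewrite -{1}(divfK z1 z) modulusM ler_pM2r ?modulus_gt0//.
rewrite modulus_le; apply: (@enestrom_kakeya _ (fun j => 'C(m + j, j)%:R) _ _ r).
- by rewrite ler0c divr_ge0// subr_ge0 ler1n; lia.
- by move=> j _; rewrite ltr0n bin_gt0 leq_addl.
- move=> j jr; apply: natr_le_real_complexM.
  have n10 : 0 < n%:R - 1 :> R by rewrite subr_gt0 ltr1n; lia.
  rewrite mulrAC ler_pdivlMr// (_ : n%:R - 1 = (n - 1)%:R); last first.
    by rewrite natrB//; lia.
  rewrite -!natrM ler_nat.
  rewrite -(leq_pmul2l (ltn0Sn j)) (mulnCA _ r) addnS -mul_bin_diag /=.
  rewrite (mulnCA j.+1) (mulnA r) (mulnC _ 'C(m + j, j)) leq_mul2l; apply/orP; right.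
  have := leq_mul jr (leqnn m); rewrite nE addnS subn1 /=; lia.
apply: (mulIf (expf_neq0 r z1)); rewrite mul0r -[RHS]Qz0 mulr_suml.
apply: eq_bigr => j _; have -> : (1 + z) ^+ r = (1 + z) ^+ (r - j) * (1 + z) ^+ j.
  by rewrite -exprD subnK ?leq_ord.
rewrite expr_div_n.
by field; rewrite expf_neq0.
Qed.

Lemma sum_bin_zero_not_ge0 : ~~ (0 <= z).
Proof.
apply: contra_eqN Bz0 => z0; rewrite gt_eqF// big_ord_recl bin0 mulr1 ltr_pwDl//.
by apply: sumr_ge0 => k _; rewrite mulr_ge0// exprn_ge0.
Qed.

Lemma K_const_bin_zero_lt (a : R) : a = r%:R / n%:R ->
  modulus z <= a / (1 - a) -> K_const a * modulus (1 + z) < modulus z `^ a.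
Proof.
move=> aE zc.
have n0 : (0 < n%:R :> R) by rewrite ltr0n; lia.
have a01 : 0 < a < 1.
  by rewrite aE divr_gt0 ?ltr0n ?ltr_pdivrMr ?mul1r ?ltr_nat //=; lia.
have /andP[a0 a1] := a01; set c := a / (1 - a) in zc *.
have c0 : 0 < c by rewrite divr_gt0// subr_gt0.
have powE (x : R) : 0 <= x -> (x `^ a) ^+ n = x ^+ r.
  by move=> x0; rewrite -powR_mulrn ?powR_ge0// -powRrM aE divfK ?gt_eqF// powR_mulrn.
have : modulus (1 + z) ^+ n * c ^+ r < modulus z ^+ r * (1 + c) ^+ n.
  rewrite -ltcR !rmorphM !rmorphXn rmorphD rmorph1 /= -!normr_modulus.
  by apply: sum_bin_zero_lt Bz0; [lia|rewrite ltcR|rewrite -modulus_le].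
rewrite -!powE ?modulus_ge0 ?(ltW c0)// -exprMn -exprMn.
rewrite ltr_pXn2r ?nnegrE ?mulr_ge0 ?modulus_ge0 ?powR_ge0
  ?addr_ge0 ?ler01 ?(ltW c0)//; last by lia.
rewrite -/c -(K_constM _ _ a01) -/c mulrA ltr_pM2r ?addr_gt0// => H.
by rewrite mulrC.
Qed.

End BinomialSectionZero.

(** * The Apollonius disc of the ratio bound *)

Section Apollonius.
Variables (R : realType) (g : R) (z : R[i]).
Hypotheses (g01 : 0 < g < 1) (ratio : modulus z <= g * modulus (1 + z)).

Lemma apollonius_sqr : complex.Re z ^+ 2 + complex.Im z ^+ 2
  <= g ^+ 2 * ((1 + complex.Re z) ^+ 2 + complex.Im z ^+ 2).
Proof.
have /andP[g0 _] := g01.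
have := ratio; rewrite -ler_sqr ?nnegrE ?mulr_ge0 ?modulus_ge0 ?(ltW g0)//.
by rewrite exprMn !modulus_sqr; case: (z) => x y /=; rewrite add0r.
Qed.

Lemma apollonius_disc :
  modulus (z - (g ^+ 2 / (1 - g ^+ 2))%:C) <= g / (1 - g ^+ 2).
Proof.
have := apollonius_sqr; have /andP[g0 g1] := g01.
have d0 : 0 < 1 - g ^+ 2 by nra.
move=> H; rewrite -ler_sqr ?nnegrE ?modulus_ge0 ?divr_ge0 ?(ltW g0) ?(ltW d0)//.
rewrite modulus_sqr.
move: H; case: (z) => x y /= H; rewrite subr0 -subr_ge0.
(* Completing the square: the gap between the squared sides is that of [apollonius_sqr] divided by
   [1 - g ^+ 2]. *)
rewrite (_ : _ - _ =
  (g ^+ 2 * ((1 + x) ^+ 2 + y ^+ 2) - (x ^+ 2 + y ^+ 2)) / (1 - g ^+ 2)).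
  by rewrite divr_ge0 ?(ltW d0) ?subr_ge0.
by field; rewrite gt_eqF.
Qed.

Lemma apollonius_half_plane : - (1 / 2) < complex.Re z.
Proof.
have := apollonius_sqr; have /andP[g0 g1] := g01.
case: (z) => x y /= H; rewrite ltNge; apply/negP => xle.
(* If [x <= -1/2] then [(1 + x) ^+ 2 <= x ^+ 2]; this leaves only [z = -1], which [H] excludes. *)
have : (1 - g ^+ 2) * ((1 + x) ^+ 2 + y ^+ 2) <= 0 by nra.
rewrite pmulr_rle0; last by nra.
by nra.
Qed.

End Apollonius.

Theorem theorem2p1 (R : realType) (r n : nat) (z : R[i])
    (hr : (1 <= r)%N) (hrn : (r < n - 1)%N)
    (hz : root (binom_section R r n) z) :
  let gamma : R := r%:R / (n%:R - 1) in
  [/\ modulus z <= r%:R / (n%:R + 1 - r%:R),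
      modulus (z - (gamma ^+ 2 / (1 - gamma ^+ 2))%:C)
        <= gamma / (1 - gamma ^+ 2),
      complex.Re z > - (1 / 2)
    & exterior (C_curve (r%:R / n%:R : R)) z].
Proof.
move: hz; rewrite rootE binom_sectionE => /eqP Bz0 gamma.
have z0 := sum_bin_zero_neq0 _ _ _ _ Bz0.
have part1 := modulus_bin_zero _ _ _ _ hr hrn Bz0.
have ratio := modulus_ratio_bin_zero _ _ _ _ hr hrn Bz0.
have r0 : (0 < r%:R :> R) by rewrite ltr0n.
have rn : r%:R < n%:R - 1 :> R.
  by rewrite -(natrB _ (_ : 1 <= n)%N) ?ltr_nat//; lia.
have n0 : (0 < n%:R :> R) by lra.
have gamma01 : 0 < gamma < 1.
  by rewrite /gamma divr_gt0 ?ltr_pdivrMr ?mul1r ?rn//; lra.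
split => //.
- exact: apollonius_disc.
- exact: apollonius_half_plane ratio.
- have a01 : 0 < (r%:R / n%:R : R) < 1.
    by rewrite divr_gt0 ?ltr_pdivrMr ?mul1r//; lra.
  (* The extra 1 in the denominator [n + 1 - r] of part (1) puts [z] strictly inside the disc of
     radius [a / (1 - a)]. *)
  have zc : modulus z < r%:R / n%:R / (1 - r%:R / n%:R).
    apply: le_lt_trans part1 _.
    have -> : r%:R / n%:R / (1 - r%:R / n%:R) = r%:R / (n%:R - r%:R) :> R.
      by field; rewrite !gt_eqF//; lra.
    by rewrite ltr_pM2l// ltf_pV2 ?posrE; lra.
  apply: exterior_ray => // t t1; apply: ray_off_curve => //.
    exact: sum_bin_zero_not_ge0 Bz0.
  by apply: (K_const_bin_zero_lt _ r n) => //; exact: ltW.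
Qed.
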